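(* Let $S\subseteq\mathrm{Gr}^{\ge0}_{k,n}$ be a positroid cell. Suppose that $F$ is a pure rational functionary with sign $s$ (respectively, strong sign $s$) on the image of $S$. Then $F$ has (strong) sign $s$ on the image of $\mathrm{pre}_IS$; $\mathrm{cyc}^{-*}F$ has (strong) sign $(-1)^{k\deg_nF}s$ on the image of $\mathrm{cyc}\,S$; and $\mathrm{refl}^*F$ has (strong) sign $s$ on the image of $\mathrm{refl}\,S$.
   Context: Grassmannians. For finite $N\subset\mathbb Z_{>0}$, $\mathrm{Gr}_{k,N}$ is the real Grassmannian of $k$-planes in $\mathbb R^N$ (row spans of full-rank $k\times N$ matrices); $\mathrm{Gr}^{\ge0}_{k,N}$ consists of points with a representative with all maximal minors $\ge0$; $\mathrm{Gr}_{k,n}=\mathrm{Gr}_{k,[n]}$. A positroid cell is a nonempty set of points of $\mathrm{Gr}^{\ge0}_{k,N}$ with a prescribed set of nonvanishing Plücker coordinates. Amplituhedron. $\mathrm{Mat}^{>0}_{N,k+4}$: real $N\times(k+4)$ matrices (rows $Z_i$) with positive maximal minors; $\tilde Z(\mathrm{rowspan}\,C)=\mathrm{rowspan}(CZ)$. For $Y\in\mathrm{Gr}_{k,k+4}$, $\langle\!\langle i_1i_2i_3i_4\rangle\!\rangle$ is the determinant of the matrix with rows a representative of $Y$ (for $Y=\tilde Z(C)$, the representative $CZ$ with $C$ having nonnegative maximal minors) and $Z_{i_1},\dots,Z_{i_4}$. Functionary: homogeneous polynomial in twistor coordinates; rational functionary: ratio of such. $F$ is pure if after replacing each $\langle\!\langle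 I\rangle\!\rangle$ by $\langle I\rangle$ it is a ratio of polynomials in each of which every monomial uses each index $i$ the same number of times; $\deg_iF$ is the number for the numerator minus that for the denominator. A rational functionary $F$ has sign $s\in\{0,1,-1\}$ on the image of $S$ if for all $Z\in\mathrm{Mat}^{>0}_{N,k+4}$ and all $Y\in\tilde Z(S)$, $F(Y)$ has sign $s$. $F$ has strong sign $+1$ on the image of $S$ if for all $C\in S$ (and all $Z$), $F(CZ)$ can be written as a ratio of polynomials in the Plücker coordinates of $C$ and the maximal minors of $Z$ with all coefficients positive; strong sign $-1$ if $-F$ has strong sign $+1$. Operations. For $N=\{j_1<\dots<j_m\}$ and a $k\times N$ matrix with columns $v_{j_t}$: $\mathrm{pre}_I$ inserts zero columns at positions $I$ ($I\cap N=\emptyset$); $\mathrm{cyc}$ makes column $j_1$ equal to $(-1)^{k-1}v_{j_m}$ and column $j_t$ equal to $v_{j_{t-1}}$ ($t\ge2$); $\mathrm{refl}$ makes column $j_t$ equal to $v_{j_{m+1-t}}$ and then multiplies the first row by $(-1)^{\binom k2}$. On functionaries with indices in $N=[n]$: $\mathrm{cyc}^{-*}$ replaces $\langle\!\langle I\rangle\!\rangle$ by $\langle\!\langle I+1\rangle\!\rangle$ (add $1$ modulo $n$ to each element, then list in increasing order), and $\mathrm{refl}^*$ replaces $\langle\!\langle I\rangle\!\rangle$ by $\langle\!\langle n+1-I\rangle\!\rangle$ (listed in increasing order). *)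

(* Defs.v *)
From mathcomp Require Import all_boot all_order all_algebra.
From mathcomp Require Import classical_sets reals.
From mathcomp Require Import mpoly.

Set Implicit Arguments.
Unset Strict Implicit.
Unset Printing Implicit Defensive.

Import Order.TTheory GRing.Theory Num.Theory.
Local Open Scope ring_scope.

(* A finite set N = {j_1 < ... < j_m} of positive integers is given by its
   increasing enumeration, an m-tuple; a k x N matrix is then a k x m matrix
   whose t-th column carries the label j_t. *)
Definition is_index_set (m : nat) (N : m.-tuple nat) : bool :=
  sorted ltn N && all (fun j => 0 < j)%N N.

Definition interval1 (n : nat) : n.-tuple nat := [tuple of iota 1 n].

Definition index_union (m p : nat) (N : m.-tuple nat) (I : p.-tuple nat) :
  (m + p).-tuple nat := [tuple of sort leq (N ++ I)].

Definition ksubset (m d : nat) := {J : {set 'I_m} | #|J| == d}.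

(* enum lists the ordinals increasingly, so elt J 0 < elt J 1 < ... *)
Definition elt (m d : nat) (J : ksubset m d) (t : 'I_d) : 'I_m :=
  enum_val (cast_ord (esym (eqP (valP J))) t).

Lemma card_imset_ksubset (m d : nat) (f : 'I_m -> 'I_m) (finj : injective f)
  (J : ksubset m d) : #|f @: val J| == d.
Proof. by rewrite (card_imset _ finj) (valP J). Qed.

Definition ksubset_map (m d : nat) (f : 'I_m -> 'I_m) (finj : injective f)
  (J : ksubset m d) : ksubset m d :=
  Sub (f @: val J) (card_imset_ksubset finj J).

Section Grassmannian.
Variable R : realType.

Definition plucker (k m : nat) (C : 'M[R]_(k, m)) (J : ksubset m k) : R :=
  \det (colsub (elt J) C).

Definition row_minor (m d : nat) (Z : 'M[R]_(m, d)) (K : ksubset m d) : R :=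
  \det (rowsub (elt K) Z).

Definition mat_pos (m d : nat) (Z : 'M[R]_(m, d)) : Prop :=
  forall K : ksubset m d, 0 < row_minor Z K.

Definition rowspan (k m : nat) (C : 'M[R]_(k, m)) : {vspace 'rV[R]_m} :=
  <<[seq row i C | i : 'I_k]>>%VS.

Definition nonneg_rep (k m : nat) (C : 'M[R]_(k, m)) : Prop :=
  row_free C /\ forall J : ksubset m k, 0 <= plucker C J.

(* The set of nonvanishing Pluecker coordinates of a point does not depend on
   the representative. *)
Definition positroid_cell (k m : nat) (S : set {vspace 'rV[R]_m}) : Prop :=
  (exists U, S U) /\
  exists B : {set ksubset m k}, forall U, S U <->
    exists C : 'M[R]_(k, m),
      [/\ nonneg_rep C, rowspan C = U
        & forall J : ksubset m k, (plucker C J != 0) = (J \in B)].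

Definition pre_mx (k m p : nat) (N : m.-tuple nat) (I : p.-tuple nat)
    (C : 'M[R]_(k, m)) : 'M[R]_(k, m + p) :=
  \matrix_(i, t)
    if [pick u | tnth N u == tnth (index_union N I) t] is Some u
    then C i u else 0.

(* ord_pred is the cyclic predecessor: it sends 0 to m - 1. *)
Definition cyc_mx (k m : nat) (C : 'M[R]_(k, m)) : 'M[R]_(k, m) :=
  \matrix_(i, t) ((if t == 0%N :> nat then (-1) ^+ k.-1 else 1)
                  * C i (ord_pred t)).

Definition refl_mx (k m : nat) (C : 'M[R]_(k, m)) : 'M[R]_(k, m) :=
  \matrix_(i, t) ((if i == 0%N :> nat then (-1) ^+ 'C(k, 2) else 1)
                  * C i (rev_ord t)).

Definition gr_map (k m m' : nat) (f : 'M[R]_(k, m) -> 'M[R]_(k, m'))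
    (S : set {vspace 'rV[R]_m}) : set {vspace 'rV[R]_m'} :=
  fun V => exists C : 'M[R]_(k, m),
    [/\ row_free C, S (rowspan C) & V = rowspan (f C)].

Definition pre (k m p : nat) (N : m.-tuple nat) (I : p.-tuple nat) :=
  gr_map (@pre_mx k m p N I).
Definition cyc (k m : nat) := gr_map (@cyc_mx k m).
Definition refl (k m : nat) := gr_map (@refl_mx k m).

End Grassmannian.

Section Functionaries.
Variable R : realType.

(* Polynomials over R in variables indexed by a finite type T. *)
Definition tpoly (T : finType) := {mpoly R[#|T|]}.

Definition tpoly_eval (T : finType) (v : T -> R) (p : tpoly T) : R :=
  p.@[fun i => v (enum_val i)].

Definition tpoly_rename (T : finType) (f : T -> T) (p : tpoly T) : tpoly T :=
  p \mPo [tuple 'X_(enum_rank (f (enum_val i))) | i < #|T|].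

(* Formal polynomials in the twistor coordinates with indices in {1, ..., n};
   the ordinal i : 'I_n stands for the index i + 1. *)
Definition twistor_poly (n : nat) := tpoly (ksubset n 4).

Record ratfun (n : nat) :=
  RatFun { num : twistor_poly n; den : twistor_poly n }.

Definition functionary (n : nat) (p : twistor_poly n) : Prop :=
  exists d : nat, p \is d.-homog.

Definition rational_functionary (n : nat) (F : ratfun n) : Prop :=
  [/\ functionary (num F), functionary (den F) & den F != 0].

Definition has_index (n : nat) (j : nat) (I : ksubset n 4) : bool :=
  [exists i in val I, i.+1 == j].

Definition index_count (n : nat) (j : nat)
    (mm : 'X_{1..#|{: ksubset n 4}|}) : nat :=
  \sum_(v < #|{: ksubset n 4}| | has_index j (enum_val v)) mm v.

Definition pure_poly (n : nat) (p : twistor_poly n) : Prop :=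
  forall j : nat, {in msupp p &, forall mm mm',
    index_count j mm = index_count j mm'}.

Definition pure (n : nat) (F : ratfun n) : Prop :=
  pure_poly (num F) /\ pure_poly (den F).

(* For a pure p the maximum is over equal numbers; it is 0 when p = 0. *)
Definition poly_index_deg (n : nat) (j : nat) (p : twistor_poly n) : nat :=
  \max_(mm <- msupp p) index_count j mm.

Definition index_deg (n : nat) (j : nat) (F : ratfun n) : int :=
  (poly_index_deg j (num F))%:Z - (poly_index_deg j (den F))%:Z.

Definition ratfun_opp (n : nat) (F : ratfun n) : ratfun n :=
  RatFun (- num F) (den F).

Definition ratfun_rename (n : nat) (f : ksubset n 4 -> ksubset n 4)
    (F : ratfun n) : ratfun n :=
  RatFun (tpoly_rename f (num F)) (tpoly_rename f (den F)).

Definition cyc_pullback (n : nat) : ratfun n -> ratfun n :=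
  ratfun_rename (ksubset_map (@ordS_inj n)).

Definition refl_pullback (n : nat) : ratfun n -> ratfun n :=
  ratfun_rename (ksubset_map (@rev_ord_inj n)).

(* The row of Z with label j; it is only used for labels j in N. *)
Definition label_row (m d : nat) (N : m.-tuple nat) (Z : 'M[R]_(m, d))
    (j : nat) : 'rV[R]_d :=
  if [pick u | tnth N u == j] is Some u then row u Z else 0.

Definition twistor (k m n : nat) (N : m.-tuple nat) (Y : 'M[R]_(k, k + 4))
    (Z : 'M[R]_(m, k + 4)) (I : ksubset n 4) : R :=
  \det (col_mx Y (\matrix_(t < 4) label_row N Z (elt I t).+1)).

Definition twistor_eval (k m n : nat) (N : m.-tuple nat)
    (C : 'M[R]_(k, m)) (Z : 'M[R]_(m, k + 4)) (p : twistor_poly n) : R :=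
  tpoly_eval (twistor N (C *m Z) Z) p.

(* Here S is a subset of Gr_{k,N} and N should contain {1, ..., n}; that F has
   a sign at a point includes that its denominator does not vanish there. *)
Definition has_sign (k m n : nat) (N : m.-tuple nat)
    (S : set {vspace 'rV[R]_m}) (F : ratfun n) (s : int) : Prop :=
  forall (Z : 'M[R]_(m, k + 4)) (C : 'M[R]_(k, m)),
    mat_pos Z -> nonneg_rep C -> S (rowspan C) ->
    twistor_eval N C Z (den F) != 0 /\
    sgz (twistor_eval N C Z (num F) / twistor_eval N C Z (den F)) = s.

Definition pos_coeffs (T : finType) (p : tpoly T) : Prop :=
  p != 0 /\ {in msupp p, forall mm, 0 < p@_mm}.

(* Values of the variables: Pluecker coordinates of C (left) and maximal minors
   of Z (right). *)
Definition CZ_coord (k m : nat) (C : 'M[R]_(k, m)) (Z : 'M[R]_(m, k + 4))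
    (v : ksubset m k + ksubset m (k + 4)) : R :=
  match v with inl J => plucker C J | inr K => row_minor Z K end.

(* The two polynomials A and B serve all C and Z at once. *)
Definition strong_positive (k m n : nat) (N : m.-tuple nat)
    (S : set {vspace 'rV[R]_m}) (F : ratfun n) : Prop :=
  exists A B : tpoly (ksubset m k + ksubset m (k + 4))%type,
  [/\ pos_coeffs A, pos_coeffs B &
    forall (Z : 'M[R]_(m, k + 4)) (C : 'M[R]_(k, m)),
      mat_pos Z -> nonneg_rep C -> S (rowspan C) ->
      [/\ twistor_eval N C Z (den F) != 0,
          tpoly_eval (CZ_coord C Z) B != 0
        & twistor_eval N C Z (num F) / twistor_eval N C Z (den F)
          = tpoly_eval (CZ_coord C Z) A / tpoly_eval (CZ_coord C Z) B]].

Definition has_strong_sign (k m n : nat) (N : m.-tuple nat)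
    (S : set {vspace 'rV[R]_m}) (F : ratfun n) (s : int) : Prop :=
  (s = 1 /\ strong_positive k N S F) \/
  (s = -1 /\ strong_positive k N S (ratfun_opp F)).

End Functionaries.

(* Main.v *)
Require Import Defs.
From mathcomp Require Import all_boot all_order all_algebra all_fingroup.
From mathcomp Require Import classical_sets reals.
From mathcomp Require Import mpoly.
From mathcomp Require Import zify.

(** Each operation acts on pairs (C, Z) with the values of Plücker coordinates,
maximal minors and twistor coordinates merely relabelled, up to controlled
signs.  For [pre] drop the rows of Z at I.  For [cyc] shift the rows of Z
backwards, the wrapped row acquiring the sign (-1)^(k+3): the Plücker
coordinates and minors are preserved, while a twistor coordinate containing the
index n acquires (-1)^(k+3) from the row and (-1)^3 from reordering, that is
(-1)^k, so a pure F is multiplied by (-1)^(k deg_n F).  For [refl] reverse the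
rows of Z and multiply on the right by a matrix of determinant
(-1)^binom(k+4,2); the signs from this matrix, from the first row of C and from
reordering four rows cancel, because binom(k+4,2) + binom(k,2) + binom(4,2) is
even.  Strong signs follow by relabelling the variables of the two
positive polynomials. *)

Set Implicit Arguments.
Unset Strict Implicit.
Unset Printing Implicit Defensive.

Import Order.TTheory GRing.Theory Num.Theory.
Local Open Scope ring_scope.

(** * Increasing enumerations of finite sets of ordinals *)

Lemma sorted_enum_ord (m : nat) (A : {pred 'I_m}) :
  sorted ltn [seq val i | i <- enum A].
Proof.
have -> : [seq val i | i <- enum A]
    = [seq val i | i <- [seq i <- enum 'I_m | i \in A]].
  by rewrite !enumT /enum_mem; congr map; apply: eq_filter.
apply: (subseq_sorted ltn_trans (map_subseq _ (filter_subseq _ _))).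
by rewrite val_enum_ord iota_ltn_sorted.
Qed.

Section Enumeration.
Variables m d : nat.

Lemma elt_in (J : ksubset m d) t : elt J t \in val J.
Proof. exact: enum_valP. Qed.

Lemma elt_surj (J : ksubset m d) i : i \in val J -> exists t, elt J t = i.
Proof.
move=> iJ; exists (cast_ord (eqP (valP J)) (enum_rank_in iJ i)).
by rewrite /elt cast_ordK enum_rankK_in.
Qed.

Lemma ltn_elt (J : ksubset m d) (s t : 'I_d) : (s < t)%N -> (elt J s < elt J t)%N.
Proof.
move=> st; have tJ : (t < size (enum (val J)))%N by rewrite -cardE (eqP (valP J)).
rewrite /elt !(enum_val_nth (elt J s)) /=.
rewrite -!(nth_map (elt J s) 0%N val) //; last exact: ltn_trans tJ.
by apply: (sorted_ltn_nth ltn_trans) => //; rewrite ?sorted_enum_ord // inE size_map //;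
   apply: ltn_trans tJ.
Qed.

Lemma ltn_inj (g : 'I_d -> 'I_m) :
  (forall s t : 'I_d, (s < t)%N -> (g s < g t)%N) -> injective g.
Proof.
move=> gmono s t gst; apply/val_inj; case: (ltngtP s t) => // /gmono;
  by rewrite gst ltnn.
Qed.

Lemma elt_inj (J : ksubset m d) : injective (elt J).
Proof. by apply: ltn_inj => s t; apply: ltn_elt. Qed.

Lemma sorted_codom (g : 'I_d -> 'I_m) :
  (forall s t : 'I_d, (s < t)%N -> (g s < g t)%N) ->
  sorted ltn [seq val (g t) | t <- enum 'I_d].
Proof.
move=> gmono; rewrite (map_comp val g).
rewrite sorted_map sorted_map; have := sorted_enum_ord 'I_d; rewrite sorted_map.
by apply: sub_sorted => s t /= /gmono.
Qed.

(** A finite set has only one increasing enumeration: the value lists of [elt J] and [g] are both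
    strictly sorted with the same members, hence equal. *)
Lemma eltE (J : ksubset m d) (g : 'I_d -> 'I_m) :
  (forall s t : 'I_d, (s < t)%N -> (g s < g t)%N) ->
  (forall t, g t \in val J) -> elt J =1 g.
Proof.
move=> gmono gJ.
(* An injective map from ['I_d] into the [d]-element set [J] is onto, by counting. *)
have imJ (h : 'I_d -> 'I_m) : injective h -> (forall t, h t \in val J) ->
    h @: 'I_d = val J.
  move=> hi hJ; apply/eqP; rewrite eqEcard card_imset // card_ord.
  rewrite (eqP (valP J)) leqnn andbT.
  by apply/fintype.subsetP => _ /imsetP[t _ ->].
have /eq_in_map gE : [seq val (elt J t) | t <- enum 'I_d]
    = [seq val (g t) | t <- enum 'I_d].
  apply: (irr_sorted_eq ltn_trans ltnn).
  - by apply: sorted_codom => s t; apply: ltn_elt.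
  - exact: sorted_codom.
  have memE (h : 'I_d -> 'I_m) : injective h -> (forall t, h t \in val J) ->
      [seq val (h t) | t <- enum 'I_d] =i [seq val i | i <- enum (val J)].
    move=> hi hJ x; rewrite (map_comp val h).
    apply/mapP/mapP => -[i]; rewrite ?mem_enum => iJ ->; exists i => //.
      by rewrite mem_enum; case/mapP: iJ => t _ ->.
    move: iJ; rewrite -(imJ h hi hJ) => /imsetP[t _ ->].
    by apply: map_f; rewrite mem_enum.
  move=> x; rewrite (memE _ (@elt_inj J) (elt_in J)).
  by rewrite (memE _ (ltn_inj gmono) gJ).
by move=> t; apply/val_inj/gE; rewrite mem_enum.
Qed.

End Enumeration.

(** * Cyclic shift and reversal of enumerations, with their parities *)

Section Shift.

(** For [d = 4] this unfolds to the same condition as [has_index m], which links the shift to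
    purity. *)
Definition has_last (m d : nat) (J : ksubset m d) : bool :=
  [exists i in val J, i.+1 == m].

Lemma has_lastP (m d : nat) (J : ksubset m d) :
  reflect (exists t, (elt J t).+1 = m) (has_last J).
Proof.
apply: (iffP existsP) => [[i /andP[iJ /eqP im]]|[t tm]].
  by have [t ti] := elt_surj iJ; exists t; rewrite ti.
by exists (elt J t); rewrite elt_in tm eqxx.
Qed.

Lemma has_last_ord_max (m d : nat) (J : ksubset m d.+1) :
  has_last J -> (elt J ord_max).+1 = m.
Proof.
case/has_lastP => t tm.
have := leq_ord t; rewrite leq_eqVlt => /orP[/eqP td|td].
  by rewrite -[RHS]tm; congr (elt J _).+1; apply/val_inj.
have /(ltn_elt J) : (t < @ord_max d)%N by [].
have := ltn_ord (elt J ord_max); lia.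
Qed.

Lemma prod_last (R : comPzRingType) (m d : nat) (J : ksubset m d) (e : R) :
  \prod_(t < d) (if (elt J t).+1 == m then e else 1)
    = if has_last J then e else 1.
Proof.
case: has_lastP => [[t tm]|nl].
  rewrite (bigD1 t) //= tm eqxx big1 ?mulr1 // => s st.
  case: eqP => // sm; case/negP: st; apply/eqP/(@elt_inj _ _ J)/val_inj/succn_inj.
  by rewrite /= sm tm.
by rewrite big1 // => t _; case: eqP => // tm; case: nl; exists t.
Qed.

Lemma val_ordS (m : nat) (i : 'I_m) :
  val (ordS i) = if i.+1 == m then 0%N else i.+1.
Proof.
rewrite /=; case: eqP => [->|/eqP im]; first by rewrite modnn.
by rewrite modn_small // ltn_neqAle im ltn_ord.
Qed.

(** Only the largest index wraps under [ordS], so the order within [J] changes only if [J] contains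
    it. That element then moves from the last position to the first, a cycle of length [d] and sign
    (-1)^(d-1). *)
Lemma elt_cyc (m d : nat) (J : ksubset m d) :
  exists2 s : 'S_d,
    forall t, elt (ksubset_map (@ordS_inj m) J) (s t) = ordS (elt J t)
    & odd_perm s = has_last J && odd d.-1.
Proof.
have inJ t : ordS (elt J t) \in val (ksubset_map (@ordS_inj m) J).
  by rewrite imset_f ?elt_in.
have [lJ|nl] := boolP (has_last J); last first.
  exists 1%g; last by rewrite odd_perm1.
  move=> t; rewrite perm1; apply: (@eltE _ _ _ (fun t => ordS (elt J t))) => // {}t u tu.
  have nlt v : (elt J v).+1 == m = false.
    by apply/negbTE; apply: contraNN nl => /eqP vm; apply/has_lastP; exists v.
  by rewrite !val_ordS !nlt ltnS ltn_elt.
case: d J inJ lJ => [|d] J inJ lJ; first by case/has_lastP: lJ => -[].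
(* This permutation sends the last position to the first and every other position up by one. *)
exists (lift_perm ord_max ord0 1); last first.
  by rewrite odd_lift_perm odd_perm1 /= addbF addbF.
pose g t := ordS (elt J ((lift_perm ord_max ord0 1)^-1%g t)).
move=> t; rewrite (@eltE _ _ _ g) /g ?permK //.
rewrite lift_permV invg1 => {}t u.
have nlt (v : 'I_d) : (elt J (lift ord_max v)).+1 == m = false.
  apply/eqP => vm; have := has_last_ord_max lJ.
  have /(ltn_elt J) : (lift ord_max v < @ord_max d)%N by rewrite lift_max /=.
  by lia.
case: (unliftP ord0 u) => [v ->|-> //].
rewrite lift_perm_lift perm1 (val_ordS (elt J (lift _ v))) nlt.
case: (unliftP ord0 t) => [w ->|-> _]; last first.
  by rewrite lift_perm_id val_ordS has_last_ord_max // eqxx.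
rewrite !lift0 => wv.
rewrite lift_perm_lift perm1 val_ordS nlt !ltnS; apply: ltn_elt.
by rewrite !lift_max.
Qed.

Definition rev_perm (d : nat) : 'S_d := perm (@rev_ord_inj d).

(** Deleting the first point and its image, the last one, leaves the reversal of d points.
    Reinserting them contributes the parity of d, and binom(d+1,2) = binom(d,2) + d. *)
Lemma odd_rev_perm (d : nat) : odd_perm (rev_perm d) = odd 'C(d, 2).
Proof.
elim: d => [|d IHd].
  by rewrite (_ : rev_perm 0 = 1%g) ?odd_perm1 //; apply/permP => -[].
have -> : rev_perm d.+1 = lift_perm ord0 ord_max (rev_perm d).
  apply/permP => t; rewrite permE.
  case: (unliftP ord0 t) => [v ->|->]; last first.
    by rewrite lift_perm_id; apply/val_inj; rewrite /= subn1.
  rewrite lift_perm_lift permE; apply/val_inj; rewrite [RHS]lift_max /=.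
  by rewrite /bump leq0n add1n subSS.
by rewrite odd_lift_perm IHd /= binS bin1 oddD addbC.
Qed.

Lemma elt_refl (m d : nat) (J : ksubset m d) t :
  elt (ksubset_map (@rev_ord_inj m) J) (rev_perm d t) = rev_ord (elt J t).
Proof.
rewrite (@eltE _ _ _ (fun t => rev_ord (elt J (rev_ord t)))) ?permE ?rev_ordK //.
  move=> {}t u tu /=; have : (elt J (rev_ord u) < elt J (rev_ord t))%N.
    by apply: ltn_elt => /=; have := ltn_ord u; lia.
  by have := ltn_ord (elt J (rev_ord t)); lia.
by move=> u; rewrite imset_f ?elt_in.
Qed.

End Shift.

(** * Determinants under weighted row permutations *)

Section Determinants.
Variable R : comPzRingType.

Lemma det_col_mx_mul (k e : nat) (A : 'M[R]_k) (B : 'M[R]_e)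
    (Y : 'M[R]_(k, k + e)) (W : 'M[R]_(e, k + e)) :
  \det (col_mx (A *m Y) (B *m W)) = \det A * \det B * \det (col_mx Y W).
Proof.
by rewrite -(det_ublock A 0 B) -det_mulmx mul_block_col !mul0mx addr0 add0r.
Qed.

(** A monomial matrix: row t of its product with M is [c t] times row [s t] of M. *)
Definition wperm_mx (d : nat) (c : 'I_d -> R) (s : 'S_d) : 'M[R]_d :=
  diag_mx (\row_t c t) *m perm_mx s.

Lemma det_wperm_mx (d : nat) (c : 'I_d -> R) (s : 'S_d) :
  \det (wperm_mx c s) = (\prod_t c t) * (-1) ^+ s.
Proof.
rewrite det_mulmx det_diag det_perm; congr (_ * _).
by apply: eq_bigr => t _; rewrite mxE.
Qed.

Lemma rowsub_wperm (m m' d e : nat) (f : 'I_m -> 'I_m') (c : 'I_m -> R)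
    (J : ksubset m d) (J' : ksubset m' d) (s : 'S_d)
    (Z : 'M[R]_(m, e)) (Z' : 'M[R]_(m', e)) :
  (forall t, elt J' (s t) = f (elt J t)) ->
  (forall u j, Z u j = c u * Z' (f u) j) ->
  rowsub (elt J) Z = wperm_mx (c \o elt J) s *m rowsub (elt J') Z'.
Proof.
move=> Js ZZ'; apply/matrixP => t j.
by rewrite -mulmxA -row_permE mul_diag_mx !mxE ZZ' Js.
Qed.

End Determinants.

(** * Relabelling of variables and the scaling of pure polynomials *)

Section TypedPolynomials.
Variable R : realType.

(** This is [tpoly_rename] with different source and target types allowed, as [pre] changes the set
    of columns. *)
Definition tpoly_map (T T' : finType) (f : T -> T') (p : tpoly R T) :
  tpoly R T' := p \mPo [tuple 'X_(enum_rank (f (enum_val i))) | i < #|T|].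

Lemma tpoly_eval_map (T T' : finType) (f : T -> T') (v : T' -> R) p :
  tpoly_eval v (tpoly_map f p) = tpoly_eval (v \o f) p.
Proof.
rewrite /tpoly_eval comp_mpoly_meval; apply: meval_eq => i.
by rewrite tnth_mktuple mevalXU enum_rankK.
Qed.

Lemma eq_tpoly_eval (T : finType) (v w : T -> R) p :
  v =1 w -> tpoly_eval v p = tpoly_eval w p.
Proof. by move=> vw; apply: meval_eq => i; rewrite vw. Qed.

(** A renamed monomial is again a monomial, so each new coefficient is a sum of old ones. *)
Lemma tpoly_map_coef_ge0 (T T' : finType) (f : T -> T') p :
  {in msupp p, forall mm, 0 < p@_mm} -> forall mm, 0 <= (tpoly_map f p)@_mm.
Proof.
move=> pp mm; rewrite /tpoly_map comp_mpolyE raddf_sum /= big_seq.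
apply: sumr_ge0 => m mp; rewrite mcoeffZ; apply: mulr_ge0; first exact/ltW/pp.
have [q ->] : exists q, \prod_(i < #|T|)
    tnth [tuple 'X_(enum_rank (f (enum_val i))) | i < #|T|] i ^+ m i
      = 'X_[q] :> {mpoly R[#|T'|]}.
  elim/big_ind: _ => [|_ _ [q1 ->] [q2 ->]|i _].
  - by exists 0%MM; rewrite mpolyX0.
  - by exists (q1 + q2)%MM; rewrite mpolyXD.
  - by rewrite tnth_mktuple mpolyXn; eexists.
by rewrite mcoeffX ler0n.
Qed.

(* Distinct monomials may be merged by f, so nonvanishing is read off the sum
   of the coefficients, which f preserves. *)
Lemma pos_coeffs_map (T T' : finType) (f : T -> T') (p : tpoly R T) :
  pos_coeffs p -> pos_coeffs (tpoly_map f p).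
Proof.
move=> [p0 pp]; split; last first.
  by move=> mm mmq; rewrite lt_def tpoly_map_coef_ge0 // -mcoeff_msupp mmq.
have: 0 < tpoly_eval (fun=> 1) p.
  have lead : mlead p \in msupp p by rewrite mlead_supp.
  rewrite /tpoly_eval mevalE (big_rem _ lead) /=.
  under eq_bigr do rewrite expr1n.
  rewrite big1_eq mulr1 ltr_pwDl ?pp // big_seq sumr_ge0 // => mm /mem_rem mmp.
  by rewrite big1 ?mulr1 ?ltW ?pp // => i _; rewrite expr1n.
have <- : tpoly_eval (fun=> 1) (tpoly_map f p) = tpoly_eval (fun=> 1) p.
  exact: tpoly_eval_map.
by apply: contraTneq => ->; rewrite /tpoly_eval meval0 ltxx.
Qed.

(* A pure polynomial is an eigenvector of the rescaling of the index n. *)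
Lemma tpoly_eval_pure_sign (n k : nat) (v : ksubset n 4 -> R) p :
  pure_poly p ->
  tpoly_eval (fun I => (-1) ^+ (k * has_last I) * v I) p
    = (-1) ^+ (k * poly_index_deg n p) * tpoly_eval v p.
Proof.
move=> hp; rewrite /tpoly_eval !mevalE mulr_sumr big_seq [RHS]big_seq.
apply: eq_bigr => mm mmp; rewrite mulrCA; congr (_ * _).
(* Purity makes all the counts equal, so the maximum is attained at any monomial [mm]. *)
have -> : poly_index_deg n p = index_count n mm.
  apply/eqP; rewrite eqn_leq; apply/andP; split.
    by apply/bigmax_leqP_seq => m' m'p _; rewrite (hp n _ _ m'p mmp).
  by rewrite /poly_index_deg (big_rem _ mmp) leq_maxl.
rewrite /index_count big_distrr /= (big_morph _ (exprD (-1)) (expr0 (-1))).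
rewrite [X in _ = X * _]big_mkcond -big_split /=; apply: eq_bigr => i _.
rewrite exprMn -exprM -mulnA; congr (_ * _).
rewrite /has_last /has_index; case: ifP => _; rewrite ?mul1n //.
by rewrite mul0n muln0.
Qed.

End TypedPolynomials.

(** * Row spans and the choice of representatives *)

Section RowSpan.
Variable R : realType.

Lemma mem_rowspan (k m : nat) (C : 'M[R]_(k, m)) (v : 'rV[R]_m) :
  (v \in rowspan C) = (v <= C)%MS.
Proof.
apply/idP/idP => [|/submxP[u ->]].
  have -> : rowspan C = <<[tuple row i C | i < k]>>%VS by [].
  move/coord_span ->; apply: summx_sub => i _; apply: scalemx_sub.
  by rewrite -tnth_nth tnth_mktuple row_sub.
rewrite mulmx_sum_row; apply: rpred_sum => i _; apply: rpredZ.
by apply/memv_span/map_f; rewrite mem_enum.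
Qed.

Lemma eq_rowspanP (k l m : nat) (C : 'M[R]_(k, m)) (D : 'M[R]_(l, m)) :
  rowspan C = rowspan D <-> (C == D)%MS.
Proof.
split=> [CD|/eqmxP CD]; last by apply/vspaceP => v; rewrite !mem_rowspan CD.
apply/andP; split; apply/row_subP => i.
  by rewrite -mem_rowspan -CD mem_rowspan row_sub.
by rewrite -mem_rowspan CD mem_rowspan row_sub.
Qed.

(** Membership in [gr_map f S] determines [C'] only up to row operations, while signs are tested on
    a given representative. Row operations pass through C -> D C P, so the preimage can be adjusted
    to hit [C'] exactly. *)
Lemma gr_map_rep (k m m' : nat) (f : 'M[R]_(k, m) -> 'M[R]_(k, m'))
    (D : 'M[R]_k) (P : 'M[R]_(m, m')) (Q : 'M[R]_(m', m))
    (S : set {vspace 'rV[R]_m}) (C' : 'M[R]_(k, m')) :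
  (forall C, f C = D *m C *m P) -> D \in unitmx -> P *m Q = 1%:M ->
  row_free C' -> gr_map f S (rowspan C') ->
  exists C, [/\ row_free C, S (rowspan C) & C' = f C].
Proof.
move=> fE Du PQ fC' [C [fC SC /eq_rowspanP/andP[C'C CC']]].
have [A CA] := submxP C'C; have [B CB] := submxP CC'.
(* The product Q P need not be the identity, but it fixes the row space of [f C], which contains the
   rows of [C']. *)
have C'Q : C' *m Q *m P = C'.
  by rewrite CA fE -!mulmxA (mulmxA P Q) PQ mul1mx.
pose C2 := invmx D *m (C' *m Q).
have C'E : C' = f C2 by rewrite fE /C2 mulKVmx.
exists C2; split=> //.
  rewrite -row_leq_rank -{1}(eqP fC') C'E fE.
  by apply: (leq_trans (mxrankM_maxl _ _)); apply: mxrankM_maxr.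
rewrite (_ : rowspan C2 = rowspan C) //; apply/eq_rowspanP/andP; split.
  rewrite /C2 CA fE -!mulmxA PQ mulmx1 !mulmxA; exact: submxMl.
have -> : C = invmx D *m B *m D *m C2.
  by rewrite /C2 -!mulmxA mulKVmx // (mulmxA B) -CB fE -!mulmxA PQ mulmx1 mulKmx.
exact: submxMl.
Qed.

End RowSpan.

(** * Transfer of signs and strong signs along relabelled coordinates *)

Section Transfer.
Variables (R : realType) (k m m' n : nat) (N : m.-tuple nat) (N' : m'.-tuple nat).
Variables (S : set {vspace 'rV[R]_m}) (S' : set {vspace 'rV[R]_m'}).
Variable f : ksubset m k + ksubset m (k + 4) -> ksubset m' k + ksubset m' (k + 4).

(* Every (C', Z') over S' comes from some (C, Z) over S with the same Plücker
   coordinates and minors along f, where the values of F' and F have numerators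
   and denominators that agree up to the signs (-1)^a and (-1)^b. *)
Definition sign_transfer (F F' : ratfun R n) (a b : nat) : Prop :=
  forall (Z' : 'M[R]_(m', k + 4)) (C' : 'M[R]_(k, m')),
  mat_pos Z' -> nonneg_rep C' -> S' (rowspan C') ->
  exists (Z : 'M[R]_(m, k + 4)) (C : 'M[R]_(k, m)),
  [/\ mat_pos Z, nonneg_rep C, S (rowspan C) &
  [/\ CZ_coord C Z =1 CZ_coord C' Z' \o f,
      twistor_eval N' C' Z' (num F') = (-1) ^+ a * twistor_eval N C Z (num F)
    & twistor_eval N' C' Z' (den F') = (-1) ^+ b * twistor_eval N C Z (den F)]].

Lemma signed_ratio (a b : nat) (x y : R) :
  ((-1) ^+ a * x) / ((-1) ^+ b * y) = (-1) ^+ (a + b) * (x / y).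
Proof. by rewrite invfM mulrACA -exprVn invrN1 exprD. Qed.

Lemma has_sign_transfer F F' a b s : sign_transfer F F' a b ->
  has_sign k N S F s -> has_sign k N' S' F' ((-1) ^+ (a + b) * s).
Proof.
move=> tr FS Z' C' Zp Cn SC.
have [Z [C [Zp1 Cn1 SC1 [_ -> ->]]]] := tr _ _ Zp Cn SC.
have [d0 <-] := FS _ _ Zp1 Cn1 SC1.
split; first by rewrite mulf_neq0 // signr_eq0.
by rewrite signed_ratio sgzM sgzX sgzN sgz1.
Qed.

(** The witnesses are [A] and [B] relabelled by [f]: their values at (C', Z') are those of [A] and
    [B] at (C, Z), and an even total sign leaves the ratio unchanged. *)
Lemma strong_positive_transfer F F' a b : ~~ odd (a + b) ->
  sign_transfer F F' a b -> strong_positive k N S F -> strong_positive k N' S' F'.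
Proof.
move=> ab tr [A [B [pA pB AB]]].
exists (tpoly_map f A), (tpoly_map f B); split; try exact: pos_coeffs_map.
move=> Z' C' Zp Cn SC.
have [Z [C [Zp1 Cn1 SC1 [CZ -> ->]]]] := tr _ _ Zp Cn SC.
have [d0 B0 rat] := AB _ _ Zp1 Cn1 SC1.
rewrite !tpoly_eval_map -!(eq_tpoly_eval _ CZ); split=> //.
  by rewrite mulf_neq0 // signr_eq0.
by rewrite signed_ratio -signr_odd (negbTE ab) mul1r.
Qed.

Lemma twistor_evalN (l : nat) (M : l.-tuple nat) C Z (p : twistor_poly R n) :
  twistor_eval (k := k) M C Z (- p) = - twistor_eval M C Z p.
Proof. by rewrite /twistor_eval /tpoly_eval mevalN. Qed.

Lemma sign_transfer_oppl F F' a b :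
  sign_transfer F F' a b -> sign_transfer (ratfun_opp F) F' a.+1 b.
Proof.
move=> tr Z' C' Zp Cn SC.
have [Z [C [Zp1 Cn1 SC1 [CZ nE dE]]]] := tr _ _ Zp Cn SC.
exists Z, C; split=> //; split=> //.
by rewrite twistor_evalN exprS mulN1r mulrNN.
Qed.

Lemma sign_transfer_oppr F F' a b :
  sign_transfer F F' a b -> sign_transfer F (ratfun_opp F') a.+1 b.
Proof.
move=> tr Z' C' Zp Cn SC.
have [Z [C [Zp1 Cn1 SC1 [CZ nE dE]]]] := tr _ _ Zp Cn SC.
exists Z, C; split=> //; split=> //.
by rewrite twistor_evalN nE exprS mulN1r mulNr.
Qed.

(** An odd total sign exchanges the two strong signs; negating one numerator makes the exponent even
    again. *)
Lemma has_strong_sign_transfer F F' a b s : sign_transfer F F' a b ->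
  has_strong_sign k N S F s -> has_strong_sign k N' S' F' ((-1) ^+ (a + b) * s).
Proof.
move=> tr; rewrite -signr_odd.
(* The exponents [a], [a.+1] and [a.+2] correspond to negating none, one or both of the numerators
   of [F] and [F']. *)
have := @strong_positive_transfer _ _ a b; have := @strong_positive_transfer _ _ a.+1 b.
have := @strong_positive_transfer _ _ a.+2 b.
rewrite addSn /= negbK; case: (odd (a + b)) => /= even2 odd1 even0.
  move=> [[-> sp]|[-> sp]]; [right|left]; split=> //.
    exact: odd1 (sign_transfer_oppr tr) sp.
  exact: odd1 (sign_transfer_oppl tr) sp.
move=> [[-> sp]|[-> sp]]; [left|right]; split=> //.
  exact: even0 tr sp.
exact: even2 (sign_transfer_oppl (sign_transfer_oppr tr)) sp.
Qed.

End Transfer.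

(** * Plücker and twistor coordinates with index set {1, ..., n} *)

Section Coordinates.
Variable R : realType.

Definition sum_map (A A' B B' : Type) (g : A -> A') (h : B -> B') (x : A + B) :
  A' + B' := match x with inl a => inl (g a) | inr b => inr (h b) end.

Lemma plucker_tr (k m : nat) (C : 'M[R]_(k, m)) J :
  plucker C J = row_minor C^T J.
Proof. by rewrite /plucker -det_tr; congr (\det _); apply/matrixP => i j; rewrite !mxE. Qed.

Lemma tnth_interval1 (n : nat) (u : 'I_n) : tnth (interval1 n) u = u.+1.
Proof. by rewrite (tnth_nth 0%N) /= nth_iota // add1n. Qed.

Lemma label_row_interval1 (n d : nat) (Z : 'M[R]_(n, d)) (i : 'I_n) :
  label_row (interval1 n) Z i.+1 = row i Z.
Proof.
rewrite /label_row; case: pickP => [u|/(_ i)]; rewrite tnth_interval1 ?eqxx //.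
by move=> /eqP[/val_inj ->].
Qed.

Lemma twistor_interval1 (k n : nat) (Y : 'M[R]_(k, k + 4)) (Z : 'M[R]_(n, k + 4))
    (I : ksubset n 4) :
  twistor (interval1 n) Y Z I = \det (col_mx Y (rowsub (elt I) Z)).
Proof.
congr (\det (col_mx _ _)); apply/row_matrixP => t.
by rewrite rowK label_row_interval1 row_rowsub.
Qed.

Lemma twistor_eval_rename (k n : nat) (C : 'M[R]_(k, n)) Z
    (f : ksubset n 4 -> ksubset n 4) p :
  twistor_eval (interval1 n) C Z (tpoly_rename f p)
    = tpoly_eval (twistor (interval1 n) (C *m Z) Z \o f) p.
Proof. exact: tpoly_eval_map. Qed.

(** Every minor of Z is a minor of Z' and every Plücker coordinate of C is one of C', so positivity
    carries over and only identities of coordinates remain to be checked. *)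
Lemma sign_transfer_coord (k m m' n : nat) (N : m.-tuple nat) (N' : m'.-tuple nat)
    (S : set {vspace 'rV[R]_m}) (S' : set {vspace 'rV[R]_m'})
    (g : ksubset m k -> ksubset m' k) (h : ksubset m (k + 4) -> ksubset m' (k + 4))
    (F F' : ratfun R n) (a b : nat) :
  (forall (Z' : 'M[R]_(m', k + 4)) (C' : 'M[R]_(k, m')),
    row_free C' -> S' (rowspan C') ->
    exists (Z : 'M[R]_(m, k + 4)) (C : 'M[R]_(k, m)),
    [/\ row_free C, S (rowspan C),
        forall J, plucker C J = plucker C' (g J),
        forall K, row_minor Z K = row_minor Z' (h K) &
        twistor_eval N' C' Z' (num F') = (-1) ^+ a * twistor_eval N C Z (num F)
        /\ twistor_eval N' C' Z' (den F') = (-1) ^+ b * twistor_eval N C Z (den F)]) ->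
  sign_transfer N N' S S' (sum_map g h) F F' a b.
Proof.
move=> tr Z' C' Zp [fC' pC'] SC'.
have [Z [C [fC SC pC mZ [nE dE]]]] := tr Z' C' fC' SC'.
exists Z, C; split=> //; first by move=> K; rewrite mZ.
  by split=> // J; rewrite pC.
by split=> // -[J|K] /=.
Qed.

End Coordinates.

(** * Insertion of zero columns *)

Section Pre.
Variables (R : realType) (n p : nat).

Lemma card_widen (d : nat) (J : ksubset n d) : #|lshift p @: val J| == d.
Proof. by rewrite card_imset ?(valP J) //; apply: lshift_inj. Qed.

Definition ksubset_widen (d : nat) (J : ksubset n d) : ksubset (n + p) d :=
  Sub (lshift p @: val J) (card_widen J).

Lemma elt_widen (d : nat) (J : ksubset n d) t :
  elt (ksubset_widen J) t = lshift p (elt J t).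
Proof.
apply: (@eltE _ _ _ (fun t => lshift p (elt J t))) => [s u su|u].
  exact: (ltn_elt J su).
by rewrite imset_f ?elt_in.
Qed.

Lemma row_minor_usubmx (d : nat) (Z : 'M[R]_(n + p, d)) (K : ksubset n d) :
  row_minor (usubmx Z) K = row_minor Z (ksubset_widen K).
Proof.
by congr (\det _); apply/matrixP => t j; rewrite !mxE elt_widen.
Qed.

Lemma plucker_row_mx0 (k : nat) (C : 'M[R]_(k, n)) (J : ksubset n k) :
  plucker C J = plucker (row_mx C (0 : 'M_(k, p))) (ksubset_widen J).
Proof.
by rewrite !plucker_tr tr_row_mx -row_minor_usubmx col_mxKu.
Qed.

Variable I : p.-tuple nat.
Hypotheses (hI : is_index_set I) (nI : forall j, j \in I -> j \notin interval1 n).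

(** The labels in [I] are positive and avoid {1, ..., n}, so they exceed n: the concatenation is
    already sorted and the new columns come last. *)
Lemma index_union_interval1 :
  index_union (interval1 n) I = iota 1 n ++ I :> seq nat.
Proof.
rewrite /=; apply: (sorted_sort leq_trans).
case/andP: hI => sI /allP pI.
rewrite sorted_pairwise; last exact: leq_trans.
rewrite pairwise_cat -!sorted_pairwise; try exact: leq_trans.
rewrite iota_sorted (sub_sorted _ sI) ?andbT; last by move=> x y /ltnW.
apply/allrelP => x y; rewrite mem_iota => xn yI.
by have := nI yI; have := pI y yI; rewrite mem_iota; lia.
Qed.

Lemma tnth_index_union_lshift (u : 'I_n) :
  tnth (index_union (interval1 n) I) (lshift p u) = u.+1.
Proof.
by rewrite (tnth_nth 0%N) index_union_interval1 nth_cat size_iota /= ltn_ord nth_iota.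
Qed.

Lemma tnth_index_union_rshift (u : 'I_p) :
  (n < tnth (index_union (interval1 n) I) (rshift n u))%N.
Proof.
rewrite (tnth_nth 0%N) index_union_interval1 nth_cat size_iota /=.
rewrite (_ : (n + u < n)%N = false) ?addKn -?tnth_nth; last by lia.
have uI := mem_tnth u I; case/andP: hI => _ /allP /(_ _ uI).
by have := nI uI; rewrite mem_iota /= => ? ?; lia.
Qed.

Lemma pre_mxE (k : nat) (C : 'M[R]_(k, n)) :
  pre_mx (interval1 n) I C = row_mx C 0.
Proof.
apply/matrixP => i t; rewrite mxE.
case: (split_ordP t) => u ->; rewrite ?row_mxEl ?row_mxEr ?mxE.
  rewrite tnth_index_union_lshift; case: pickP => [v|/(_ u)]; rewrite tnth_interval1 ?eqxx //.
  by move=> /eqP[/val_inj ->].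
case: pickP => // v; rewrite tnth_interval1 => /eqP vE; have := tnth_index_union_rshift u.
by rewrite -vE ltnS leqNgt ltn_ord.
Qed.

Lemma label_row_index_union (d : nat) (Z : 'M[R]_(n + p, d)) (i : 'I_n) :
  label_row (index_union (interval1 n) I) Z i.+1 = row i (usubmx Z).
Proof.
rewrite /label_row; case: pickP => [t|/(_ (lshift p i))]; last first.
  by rewrite tnth_index_union_lshift eqxx.
case: (split_ordP t) => u -> /eqP uE.
  move: uE; rewrite tnth_index_union_lshift => -[/val_inj ->].
  by apply/rowP => j; rewrite !mxE.
by have := tnth_index_union_rshift u; rewrite uE ltnS leqNgt ltn_ord.
Qed.

Lemma pre_transfer (k : nat) (S : set {vspace 'rV[R]_n}) (F : ratfun R n) :
  sign_transfer (interval1 n) (index_union (interval1 n) I)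
    S (pre k (interval1 n) I S)
    (sum_map (@ksubset_widen k) (@ksubset_widen (k + 4))) F F 0 0.
Proof.
apply: sign_transfer_coord => Z' C' fC' SC'.
(* Here [pre_mx] is right multiplication by the block row (1 0), with its transpose as right
   inverse. *)
have [|||C [fC SC C'E]] :=
    @gr_map_rep _ _ _ _ _ 1%:M (row_mx 1%:M 0) (col_mx 1%:M 0) S C' _ _ _ fC' SC'.
- by move=> C; rewrite pre_mxE mul1mx mul_mx_row mulmx1 mulmx0.
- exact: unitmx1.
- by rewrite mul_row_col mulmx1 mulmx0 addr0.
rewrite pre_mxE in C'E.
(* The zero columns of [C'] cancel the lower rows of [Z'], and the twistor coordinates of [q] only
   use labels up to n. *)
have evE (q : twistor_poly R n) : twistor_eval (index_union (interval1 n) I) C' Z' q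
    = twistor_eval (interval1 n) C (usubmx Z') q.
  apply: eq_tpoly_eval => J; congr (\det (col_mx _ _)).
    by rewrite C'E -{1}(vsubmxK Z') mul_row_col mul0mx addr0.
  by apply/row_matrixP => t; rewrite !rowK label_row_index_union label_row_interval1.
exists (usubmx Z'), C; split=> //.
- by move=> J; rewrite C'E plucker_row_mx0.
- exact: row_minor_usubmx.
- by rewrite !evE !mul1r.
Qed.

End Pre.

(** * The cyclic shift *)

Section Cyc.
Variables (R : realType) (n : nat).

Definition last_weight (e : R) (u : 'I_n) : R := if u.+1 == n then e else 1.

Lemma rowsub_cyc (d q : nat) (e : R) (J : ksubset n d) (Z Z' : 'M[R]_(n, q)) :
  (forall u j, Z u j = last_weight e u * Z' (ordS u) j) ->
  exists2 A : 'M[R]_d,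
    rowsub (elt J) Z = A *m rowsub (elt (ksubset_map (@ordS_inj n) J)) Z'
    & \det A = if has_last J then e * (-1) ^+ d.-1 else 1.
Proof.
move=> ZZ'; have [s sE odds] := elt_cyc J.
exists (wperm_mx (last_weight e \o elt J) s); first exact: rowsub_wperm sE ZZ'.
rewrite det_wperm_mx prod_last odds -signr_odd.
by case: has_last => //=; rewrite ?mulr1 ?signr_odd.
Qed.

(** The weight (-1)^(k-1) of the wrapped column cancels the sign of the cycle of length k; both
    occur exactly when [J] contains the last index. *)
Lemma plucker_cyc (k : nat) (C : 'M[R]_(k, n)) (J : ksubset n k) :
  plucker C J = plucker (cyc_mx C) (ksubset_map (@ordS_inj n) J).
Proof.
rewrite !plucker_tr; have [|A AE detA] :=
    @rowsub_cyc k k ((-1) ^+ k.-1) J C^T (cyc_mx C)^T.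
  move=> u j; rewrite !mxE ordSK val_ordS /last_weight.
  by case: eqP => _; rewrite ?mul1r // mulrA -expr2 sqrr_sign mul1r.
rewrite /row_minor AE det_mulmx detA.
by case: has_last; rewrite ?mul1r // -expr2 sqrr_sign mul1r.
Qed.

(** The weight (-1)^(k+3) is the sign of a cycle of length k + 4, so maximal minors keep their
    values. *)
Definition uncyc_rows (k : nat) (Z' : 'M[R]_(n, k + 4)) : 'M[R]_(n, k + 4) :=
  \matrix_(u, j) (last_weight ((-1) ^+ (k + 3)) u * Z' (ordS u) j).

Lemma row_minor_uncyc (k : nat) (Z' : 'M[R]_(n, k + 4)) K :
  row_minor (uncyc_rows Z') K = row_minor Z' (ksubset_map (@ordS_inj n) K).
Proof.
have [|A AE detA] := @rowsub_cyc (k + 4) (k + 4) ((-1) ^+ (k + 3)) K (uncyc_rows Z') Z'.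
  by move=> u j; rewrite mxE.
rewrite /row_minor AE det_mulmx detA (_ : (k + 4).-1 = (k + 3)%N) ?addnS //.
by case: has_last; rewrite ?mul1r // -expr2 sqrr_sign mul1r.
Qed.

Lemma mul_uncyc (k : nat) (C : 'M[R]_(k, n)) (Z' : 'M[R]_(n, k + 4)) :
  C *m uncyc_rows Z' = cyc_mx C *m Z'.
Proof.
apply/matrixP => i j; rewrite !mxE [RHS](reindex_inj (@ordS_inj n)) /=.
apply: eq_bigr => u _; rewrite !mxE ordSK val_ordS mulrA /last_weight.
congr (_ * _); rewrite mulrC; case: eqP => // _; congr (_ * _).
(* The weights (-1)^(k-1) and (-1)^(k+3) agree for k > 0. For k = 0 the truncated [k.-1] breaks
   this, but then there is no row [i]. *)
case: k C i {Z' j} => [|k] _; first by case.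
by move=> _; rewrite addSn !addnS addn0 !exprS !mulN1r !opprK.
Qed.

Lemma twistor_uncyc (k : nat) (C : 'M[R]_(k, n)) (Z' : 'M[R]_(n, k + 4)) I :
  twistor (interval1 n) (cyc_mx C *m Z') Z' (ksubset_map (@ordS_inj n) I)
  = (-1) ^+ (k * has_last I)
    * twistor (interval1 n) (C *m uncyc_rows Z') (uncyc_rows Z') I.
Proof.
have [|A AE detA] := @rowsub_cyc 4 (k + 4) ((-1) ^+ (k + 3)) I (uncyc_rows Z') Z'.
  by move=> u j; rewrite mxE.
rewrite !twistor_interval1 mul_uncyc AE -{2}[cyc_mx C *m Z']mul1mx.
rewrite det_col_mx_mul det1 mul1r detA.
case: has_last; rewrite ?muln0 ?mul1r // muln1 mulrA -exprD -exprD.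
(* The claimed exponent k, the row weight k + 3 and the 3 from cycling four rows have an even
   sum. *)
by rewrite (_ : (k + (k + 3 + 4.-1) = (k + 3) * 2)%N) ?exprM ?sqrr_sign ?mul1r //; lia.
Qed.

Lemma cyc_rep (k : nat) (S : set {vspace 'rV[R]_n}) (C' : 'M[R]_(k, n)) :
  row_free C' -> cyc k S (rowspan C') ->
  exists C, [/\ row_free C, S (rowspan C) & C' = cyc_mx C].
Proof.
pose c (t : 'I_n) : R := if t == 0%N :> nat then (-1) ^+ k.-1 else 1.
(* Right multiplication by [W] is [cyc_mx]; the transpose turns the row action of [wperm_mx] into a
   column action. *)
pose W := (wperm_mx c (perm (@ord_pred_inj n)))^T.
apply: (@gr_map_rep _ _ _ _ _ 1%:M W (invmx W)).
- move=> C; rewrite mul1mx -[RHS]trmxK trmx_mul trmxK.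
  by apply/matrixP => i t; rewrite -mulmxA -row_permE mul_diag_mx !mxE permE.
- exact: unitmx1.
- apply: mulmxV; rewrite unitmx_tr unitmxE det_wperm_mx unitrM unitrX ?unitrN1 // andbT.
  rewrite unitfE; apply/prodf_neq0 => t _; rewrite /c.
  by case: ifP => _; rewrite ?signr_eq0 ?oner_eq0.
Qed.

Lemma cyc_transfer (k : nat) (S : set {vspace 'rV[R]_n}) (F : ratfun R n) :
  pure F ->
  sign_transfer (interval1 n) (interval1 n) S (cyc k S)
    (sum_map (@ksubset_map n k _ (@ordS_inj n)) (@ksubset_map n (k + 4) _ (@ordS_inj n)))
    F (cyc_pullback F)
    (k * poly_index_deg n (num F)) (k * poly_index_deg n (den F)).
Proof.
move=> [pn pd]; apply: sign_transfer_coord => Z' C' fC' SC'.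
have [C [fC SC ->]] := cyc_rep fC' SC'.
exists (uncyc_rows Z'), C; split=> //.
- exact: plucker_cyc.
- exact: row_minor_uncyc.
rewrite !twistor_eval_rename /twistor_eval -!tpoly_eval_pure_sign //.
by split; apply: eq_tpoly_eval => I; apply: twistor_uncyc.
Qed.

End Cyc.

(** * The reflection *)

Section Refl.
Variables (R : realType) (n : nat).

Lemma rowsub_refl (d q : nat) (J : ksubset n d) (Z : 'M[R]_(n, q)) :
  rowsub (elt J) (rowsub (@rev_ord n) Z)
  = perm_mx (rev_perm d) *m rowsub (elt (ksubset_map (@rev_ord_inj n) J)) Z.
Proof.
apply/matrixP => t j; rewrite -row_permE !mxE.
by rewrite elt_refl.
Qed.

Lemma det_rev_perm_mx (d : nat) :
  \det (perm_mx (rev_perm d)) = (-1) ^+ 'C(d, 2) :> R.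
Proof. by rewrite det_perm odd_rev_perm signr_odd. Qed.

Definition first_row_sign (k : nat) : 'M[R]_k :=
  diag_mx (\row_i (if i == 0%N :> nat then (-1) ^+ 'C(k, 2) else 1)).

Lemma det_first_row_sign (k : nat) : \det (first_row_sign k) = (-1) ^+ 'C(k, 2).
Proof.
rewrite det_diag; case: k => [|k]; first by rewrite big_ord0.
by rewrite big_ord_recl mxE /= big1 ?mulr1 // => i _; rewrite mxE.
Qed.

Lemma refl_mxE (k : nat) (C : 'M[R]_(k, n)) :
  refl_mx C = first_row_sign k *m C *m perm_mx (rev_perm n).
Proof.
rewrite -mulmxA -[rev_perm n]invgK -col_permE.
apply/matrixP => i t; rewrite mul_diag_mx !mxE; congr (_ * C i _).
by apply: (canRL (permK _)); rewrite permE rev_ordK.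
Qed.

Lemma plucker_refl (k : nat) (C : 'M[R]_(k, n)) (J : ksubset n k) :
  plucker C J = plucker (refl_mx C) (ksubset_map (@rev_ord_inj n) J).
Proof.
set J' := ksubset_map _ J.
have -> : plucker (refl_mx C) J' = (-1) ^+ 'C(k, 2) * row_minor (rowsub (@rev_ord n) C^T) J'.
  rewrite -det_first_row_sign -[row_minor _ _]det_tr -det_mulmx; congr (\det _).
  by apply/matrixP => i j; rewrite mul_diag_mx !mxE.
have C2 : C^T = rowsub (@rev_ord n) (rowsub (@rev_ord n) C^T).
  by apply/matrixP => i j; rewrite !mxE rev_ordK.
by rewrite plucker_tr {1}C2 /row_minor rowsub_refl det_mulmx det_rev_perm_mx.
Qed.

(* The last factor only serves to restore the positivity of the minors: its
   determinant is the sign by which reversing the rows changes them. *)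
Definition refl_rows (k : nat) (Z' : 'M[R]_(n, k + 4)) : 'M[R]_(n, k + 4) :=
  rowsub (@rev_ord n) Z' *m perm_mx (rev_perm (k + 4)).

Lemma row_minor_refl (k : nat) (Z' : 'M[R]_(n, k + 4)) K :
  row_minor (refl_rows Z') K = row_minor Z' (ksubset_map (@rev_ord_inj n) K).
Proof.
rewrite /row_minor /refl_rows -mul_rowsub_mx rowsub_refl !det_mulmx det_rev_perm_mx.
by rewrite mulrAC -expr2 sqrr_sign mul1r.
Qed.

Lemma twistor_refl (k : nat) (C : 'M[R]_(k, n)) (Z' : 'M[R]_(n, k + 4)) I :
  twistor (interval1 n) (refl_mx C *m Z') Z' (ksubset_map (@rev_ord_inj n) I)
  = twistor (interval1 n) (C *m refl_rows Z') (refl_rows Z') I.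
Proof.
rewrite !twistor_interval1 /refl_rows -mul_rowsub_mx mulmxA -mul_col_mx.
rewrite rowsub_refl refl_mxE -[_ *m Z']mulmxA -row_permE.
have -> : row_perm (rev_perm n) Z' = rowsub (@rev_ord n) Z'.
  by apply/matrixP => i j; rewrite !mxE permE.
(* Identity factors are inserted so that [det_col_mx_mul] reduces both sides to signs times one
   common determinant. *)
rewrite -[C *m rowsub _ _ in RHS]mul1mx -[rowsub (elt _) Z' in LHS]mul1mx.
rewrite -[first_row_sign k *m C *m _]mulmxA det_mulmx !det_col_mx_mul !det1.
rewrite !det_rev_perm_mx det_first_row_sign mul1r mulr1 mulrAC -exprD.
(* The sign exponents of the two sides differ by the even number 4k + 12. *)
have binE : ('C(4, 2) + 'C(k + 4, 2) = 'C(k, 2) + (2 * k + 6) * 2)%N.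
  have binS2 j : 'C(j.+1, 2) = ('C(j, 2) + j)%N by rewrite binS bin1.
  have -> : 'C(k + 4, 2) = ('C(k, 2) + k + k.+1 + k.+2 + k.+3)%N.
    by rewrite (addnC k 4) !binS2.
  have -> : 'C(4, 2) = 6%N by [].
  lia.
by rewrite binE exprD exprM sqrr_sign mulr1.
Qed.

Lemma refl_rep (k : nat) (S : set {vspace 'rV[R]_n}) (C' : 'M[R]_(k, n)) :
  row_free C' -> refl k S (rowspan C') ->
  exists C, [/\ row_free C, S (rowspan C) & C' = refl_mx C].
Proof.
apply: (@gr_map_rep _ _ _ _ _ (first_row_sign k) (perm_mx (rev_perm n))
          (invmx (perm_mx (rev_perm n)))).
- exact: refl_mxE.
- by rewrite unitmxE det_first_row_sign unitrX ?unitrN1.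
- by apply: mulmxV; rewrite unitmx_perm.
Qed.

Lemma refl_transfer (k : nat) (S : set {vspace 'rV[R]_n}) (F : ratfun R n) :
  sign_transfer (interval1 n) (interval1 n) S (refl k S)
    (sum_map (@ksubset_map n k _ (@rev_ord_inj n)) (@ksubset_map n (k + 4) _ (@rev_ord_inj n)))
    F (refl_pullback F) 0 0.
Proof.
apply: sign_transfer_coord => Z' C' fC' SC'.
have [C [fC SC ->]] := refl_rep fC' SC'.
exists (refl_rows Z'), C; split=> //.
- exact: plucker_refl.
- exact: row_minor_refl.
rewrite !twistor_eval_rename !mul1r.
by split; apply: eq_tpoly_eval => I; apply: twistor_refl.
Qed.

End Refl.

(** As -1 is its own inverse, subtracting the degree of the denominator in the exponent amounts to
    adding it. *)
Lemma signz_index_deg (R : realType) (k n : nat) (F : ratfun R n) :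
  (-1) ^ (k%:Z * index_deg n F)
  = (-1) ^+ (k * poly_index_deg n (num F) + k * poly_index_deg n (den F)) :> int.
Proof.
rewrite /index_deg mulrBr exprzDr ?unitrN1 // exprD; congr (_ * _).
by rewrite -exprz_inv invrN1.
Qed.

Theorem theorem11p2 (R : realType) (k n : nat)
  (S : set {vspace 'rV[R]_n}) (hS : positroid_cell k S)
  (F : ratfun R n) (hF : rational_functionary F) (hpure : pure F)
  (s : int) (hs : s \in [:: 0; 1; -1]) :
  (has_sign k (interval1 n) S F s ->
    [/\ forall (p : nat) (I : p.-tuple nat), is_index_set I ->
          (forall j, j \in I -> j \notin interval1 n) ->
          has_sign k (index_union (interval1 n) I)
            (pre k (interval1 n) I S) F s,
        has_sign k (interval1 n) (cyc k S) (cyc_pullback F)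
          ((-1) ^ (k%:Z * index_deg n F) * s)
      & has_sign k (interval1 n) (refl k S) (refl_pullback F) s])
  /\
  (has_strong_sign k (interval1 n) S F s ->
    [/\ forall (p : nat) (I : p.-tuple nat), is_index_set I ->
          (forall j, j \in I -> j \notin interval1 n) ->
          has_strong_sign k (index_union (interval1 n) I)
            (pre k (interval1 n) I S) F s,
        has_strong_sign k (interval1 n) (cyc k S) (cyc_pullback F)
          ((-1) ^ (k%:Z * index_deg n F) * s)
      & has_strong_sign k (interval1 n) (refl k S) (refl_pullback F) s]).
Proof.
split=> hF'; split.
- by move=> p I hI nI; have := has_sign_transfer (pre_transfer hI nI F) hF'; rewrite mul1r.
- by rewrite signz_index_deg; apply: has_sign_transfer (cyc_transfer hpure) hF'.
- by have := has_sign_transfer (@refl_transfer R n k S F) hF'; rewrite mul1r.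
- by move=> p I hI nI; have := has_strong_sign_transfer (pre_transfer hI nI F) hF'; rewrite mul1r.
- by rewrite signz_index_deg; apply: has_strong_sign_transfer (cyc_transfer hpure) hF'.
- by have := has_strong_sign_transfer (@refl_transfer R n k S F) hF'; rewrite mul1r.
Qed.
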